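(* Let $r$ be a positive integer, and for every collectable $r$-pattern $P$ let $m_P$ be a positive integer. Then there exists an ordered $r$-uniform hypergraph matching $\mathcal{H}$ such that for every collectable $r$-pattern $P$ every $P$-clique contained in $\mathcal{H}$ has size at most $m_P$, and such that \[|\mathcal{H}|= \max_{\lambda^{(1)} \succ \lambda^{(2)} \succ \dots \succ \lambda^{(r)}}\ \prod_{P\in \mathcal{P}(\lambda^{(1)})\cup\dots\cup \mathcal{P}(\lambda^{(r)})} m_{P},\] where the maximum is over all sequences $\lambda^{(1)} \succ \lambda^{(2)} \succ \dots \succ \lambda^{(r)}$ of ordered partitions of $r$.
   Context: An $r$-uniform hypergraph matching is a finite collection of pairwise disjoint sets (edges), each of size $r$; an ordered one additionally has a total ordering of its vertex set (the union of the edges). An $r$-pattern is a string in $\{\mathrm{A},\mathrm{B}\}^{2r}$ starting with $\mathrm{A}$ with exactly $r$ letters $\mathrm{A}$ and $r$ letters $\mathrm{B}$. Two distinct edges $e,f$ form the $r$-pattern obtained by listing the vertices of $e\cup f$ in increasing order, writing $\mathrm{A}$ for vertices of the edge containing the smallest vertex and $\mathrm{B}$ for the other edge. For an $r$-pattern $P$, a $P$-clique is a subset of edges any two distinct of which form $P$; its size is its number of edges. A block partition of an $r$-pattern $P$ is a division of the string into consecutive blocks of even length such that each block reads $\mathrm{A}^k\mathrm{B}^k$ or $\mathrm{B}^k\mathrm{A}^k$ for some $k\ge1$; each pattern has at most one block partition, and $P$ is collectable if it has one. An ordered partition of $r$ is a sequence $\lambda=(\lambda_1,\dots,\lambda_s)$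 of positive integers with sum $r$ ($s$ is its number of parts). For ordered partitions $\lambda,\lambda'$ of $r$, $\lambda\succ\lambda'$ means $\lambda'$ is obtained from $\lambda$ by splitting some summands into consecutive smaller summands (keeping the order), i.e. as partitions of $\{1,\dots,r\}$ into intervals, $\lambda'$ refines $\lambda$; in a chain $\lambda^{(1)}\succ\dots\succ\lambda^{(r)}$, $\lambda^{(s)}$ has exactly $s$ parts. For an ordered partition $\lambda=(\lambda_1,\dots,\lambda_s)$, $\mathcal{P}(\lambda)$ is the set of collectable $r$-patterns whose block partition consists of $s$ blocks of lengths $2\lambda_1,\dots,2\lambda_s$ in this order. *)

(* Defs.v *)
From HB Require Import structures.
From mathcomp Require Import all_boot all_order.

Set Implicit Arguments.
Unset Strict Implicit.
Unset Printing Implicit Defensive.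

Inductive letter := A | B.

Definition bool_of_letter (l : letter) : bool := if l is A then true else false.
Definition letter_of_bool (b : bool) : letter := if b then A else B.
Lemma bool_of_letterK : cancel bool_of_letter letter_of_bool.
Proof. by case. Qed.

HB.instance Definition _ := Finite.copy letter (can_type bool_of_letterK).

Definition is_pattern (r : nat) (P : (2 * r).-tuple letter) : bool :=
  [&& ohead P == Some A, count_mem A P == r & count_mem B P == r].

(* A finite totally ordered vertex type T, every vertex being covered, together
   with the set H of edges. *)
Definition ordered_matching (d : Order.disp_t) (T : finOrderType d) (r : nat)
    (H : {set {set T}}) : bool :=
  [&& cover H == [set: T], trivIset H & [forall e in H, #|e| == r]].

Definition formed_pattern (d : Order.disp_t) (T : finOrderType d)
    (e f : {set T}) : seq letter :=
  let vs := sort <=%O (enum (e :|: f)) in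
  if vs is v :: _ then
    let first := if v \in e then e else f in
    [seq if x \in first then A else B | x <- vs]
  else [::].

Definition is_clique (d : Order.disp_t) (T : finOrderType d) (P : seq letter)
    (K : {set {set T}}) : bool :=
  [forall e in K, forall f in K, (e != f) ==> (formed_pattern e f == P)].

Definition is_block (w : seq letter) : bool :=
  let k := (size w)./2 in
  (0 < k) && ((w == nseq k A ++ nseq k B) || (w == nseq k B ++ nseq k A)).

(* A division of a string into consecutive blocks is given by the sequence of
   the lengths of its blocks. *)
Definition block_partition (w : seq letter) (lens : seq nat) : bool :=
  (sumn lens == size w) && all is_block (reshape lens w).

Definition collectable (r : nat) (P : (2 * r).-tuple letter) : Prop :=
  is_pattern P /\ exists lens : seq nat, block_partition P lens.

Definition ordered_partition (r : nat) (lam : seq nat) : bool :=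
  all (leq 1) lam && (sumn lam == r).

(* lam' is obtained from lam by splitting summands: lam' can be cut into
   size lam consecutive groups, the i-th one consisting of k_i summands, whose
   sums are the summands of lam. *)
Definition splits (lam lam' : seq nat) : bool :=
  [exists k : (size lam).-tuple 'I_(size lam').+1,
    (sumn (map val k) == size lam') &&
    (map sumn (reshape (map val k) lam') == lam)].

(* An ordered partition of r has at most r parts, each at most r, hence is
   represented in this finite type. *)
Definition small_seq (r : nat) := {bseq r of 'I_r.+1}.

Definition parts (r : nat) (lam : small_seq r) : seq nat := map val lam.

(* The component of index i, counted from 0, has i + 1 parts. *)
Definition is_chain (r : nat) (c : r.-tuple (small_seq r)) : bool :=
  [&& all (fun lam => ordered_partition r (parts lam)) c,
      [forall i : 'I_r, size (parts (tnth c i)) == i.+1]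
    & sorted (fun lam lam' => splits (parts lam) (parts lam')) c].

Definition patterns_of (r : nat) (lam : seq nat) : {set (2 * r).-tuple letter} :=
  [set P | is_pattern P && block_partition P [seq 2 * l | l <- lam]].

(* Main.v *)
Require Import Defs.
From mathcomp Require Import all_boot all_order.

(* Fix a chain lam^(1), ..., lam^(r) attaining the maximum and let S be the union
   of the sets P(lam^(s)). The edges are the vectors x with coordinates
   x_P < m_P for P in S, the coarsest partitions being the most significant: the
   j-th vertices of the edges are ordered lexicographically by reading, for each
   P in turn, the part of lam^(s) containing j and then x_P, the latter reversed
   in the parts where P reads B^k A^k. If P is the first coordinate at which x
   and y differ, then on each part of lam^(s) the two edges are separated in the
   direction prescribed by P, so that they form exactly P. Hence x |-> x_P is
   injective on every P-clique. *)

Import Order.TTheory.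

(** * Divisions into intervals and their refinement *)

(* Index of the interval containing j when lam is seen as a division of
   {0, ..., sumn lam - 1} into intervals; it is size lam for larger j. *)
Fixpoint part (lam : seq nat) (j : nat) : nat :=
  if lam is l :: lam' then (if j < l then 0 else (part lam' (j - l)).+1) else 0.

Lemma part_le (lam : seq nat) : {homo part lam : j k / j <= k}.
Proof.
elim: lam => //= l lam IH j k le_jk.
case: (ltnP j l) => // le_lj; rewrite (ltnNge k) (leq_trans le_lj le_jk) /= ltnS.
exact/IH/leq_sub2r.
Qed.

Lemma part_lt_size (s : seq nat) (j : nat) : j < sumn s -> part s j < size s.
Proof.
elim: s j => //= l s IH j lt_j; case: (ltnP j l) => // le_lj.
by apply: IH; rewrite ltn_subLR.
Qed.

Lemma part_cat (s1 s2 : seq nat) (j : nat) :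
  part (s1 ++ s2) j =
    if j < sumn s1 then part s1 j else size s1 + part s2 (j - sumn s1).
Proof.
elim: s1 j => [|l s1 IH] j /=; first by rewrite subn0.
rewrite IH; case: (ltnP j l) => [lt_jl|le_lj]; first by rewrite ltn_addr.
by rewrite ltn_subLR // subnDA; case: ifP.
Qed.

(** Induction on the groups, cutting [lam] after its first group [s]. Equal fine indices lie on the
    same side of the cut, because they are below [size s] on its left and at least [size s] on its
    right. *)
Lemma part_coarsen (ks lam : seq nat) (j k : nat) :
    sumn ks = size lam -> part lam j = part lam k ->
  part (map sumn (reshape ks lam)) j = part (map sumn (reshape ks lam)) k.
Proof.
elim: ks lam j k => //= k0 ks IH lam j k sz_ks.
have /IH{}IH : sumn ks = size (drop k0 lam) by rewrite size_drop -sz_ks addKn.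
rewrite -{1 2}(cat_take_drop k0 lam) !part_cat.
set s := take k0 lam.
case: (ltnP j (sumn s)) => [lt_j|le_j]; case: (ltnP k (sumn s)) => [lt_k|le_k] //.
- by move=> e; have := part_lt_size _ _ lt_j; rewrite e ltnNge leq_addr.
- by move=> e; have := part_lt_size _ _ lt_k; rewrite -e ltnNge leq_addr.
by move/addnI/IH->.
Qed.

(** Pointwise consequence of [splits] whose transitivity is immediate; it makes the members of a
    chain pairwise comparable. *)
Definition refines (r : nat) (lam mu : seq nat) : bool :=
  [forall j : 'I_r, forall k : 'I_r,
    (part mu j == part mu k) ==> (part lam j == part lam k)].

Lemma refinesP (r : nat) (lam mu : seq nat) :
  reflect (forall j k, j < r -> k < r ->
             part mu j = part mu k -> part lam j = part lam k)
          (refines r lam mu).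
Proof.
apply: (iffP idP) => [h j k lt_j lt_k /eqP e|h].
  move/forallP/(_ (Ordinal lt_j))/forallP/(_ (Ordinal lt_k))/implyP: h.
  by move/(_ e)/eqP.
apply/forallP => j; apply/forallP => k; apply/implyP => /eqP e.
by apply/eqP/h.
Qed.

Lemma refines_refl (r : nat) : reflexive (refines r).
Proof. by move=> lam; apply/refinesP. Qed.

Lemma refines_trans (r : nat) : transitive (refines r).
Proof.
move=> mu lam nu /refinesP h1 /refinesP h2; apply/refinesP => j k lt_j lt_k e.
by apply: h1 => //; apply: h2.
Qed.

Lemma splits_refines (r : nat) (lam mu : seq nat) :
  splits lam mu -> refines r lam mu.
Proof.
case/existsP => ks /andP[/eqP sz /eqP e]; apply/refinesP => j k _ _ ejk.
by rewrite -e; apply: part_coarsen.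
Qed.

(** * Collectable patterns as interleavings of two edges *)

(* The i-th sign tells whether the i-th block reads A^k B^k. *)
Definition signs (lam : seq nat) (w : seq letter) : seq bool :=
  [seq ohead v == Some A | v <- reshape [seq 2 * l | l <- lam] w].

Definition letter_of (bj : bool * nat) : letter := if bj.1 then A else B.

(* The vertices of two edges in increasing order: (true, j) is the j-th vertex
   of the first edge, (false, j) that of the second one. *)
Fixpoint interleave (lam : seq nat) (sg : seq bool) : seq (bool * nat) :=
  if (lam, sg) is (l :: lam', s :: sg') then
    [seq (s, j) | j <- iota 0 l] ++ [seq (~~ s, j) | j <- iota 0 l] ++
    [seq (bj.1, l + bj.2) | bj <- interleave lam' sg']
  else [::].

Lemma map_letter_iota (s : bool) (l : nat) :
  [seq letter_of bj | bj <- [seq (s, j) | j <- iota 0 l]] =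
  nseq l (letter_of (s, 0)).
Proof.
rewrite -map_comp; rewrite -[in RHS](size_iota 0 l).
by elim: (iota 0 l) => //= a t ->.
Qed.

Lemma letters_interleave (lam : seq nat) (w : seq letter) :
    block_partition w [seq 2 * l | l <- lam] ->
  [seq letter_of bj | bj <- interleave lam (signs lam w)] = w.
Proof.
rewrite /block_partition; elim: lam w => [|l lam IH] w /=.
  by rewrite eq_sym size_eq0 => /andP[/eqP->].
case/andP => /eqP sz /andP[blk all_blk].
have sz_take : size (take (2 * l) w) = 2 * l.
  by rewrite size_takel // -sz leq_addr.
have {IH} IHw : [seq letter_of bj | bj <-
    interleave lam (signs lam (drop (2 * l) w))] = drop (2 * l) w.
  by apply: IH; rewrite all_blk size_drop -sz addKn eqxx.
rewrite !map_cat !map_letter_iota -map_comp.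
rewrite (@eq_map _ _ (letter_of \o _) letter_of) // IHw catA.
rewrite -[RHS](cat_take_drop (2 * l) w); congr (_ ++ _).
move: blk; rewrite /is_block sz_take mul2n doubleK.
(* The block is nonempty, so its first letter tells the two possible words apart. *)
by case: l {sz sz_take IHw all_blk} => //= l /orP[]/eqP->.
Qed.

Lemma mem_interleave (lam : seq nat) (sg : seq bool) (b : bool) (j : nat) :
  size sg = size lam -> ((b, j) \in interleave lam sg) = (j < sumn lam).
Proof.
elim: lam sg b j => [|l lam IH] [|s sg] b j //= [] sz; rewrite !mem_cat.
have mem_blk c : ((b, j) \in [seq (c, i) | i <- iota 0 l]) = (b == c) && (j < l).
  apply/mapP/andP => [[i]|[/eqP-> lt_j]].
    by rewrite mem_iota => /andP[_ lt_i] [-> ->].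
  by exists j => //; rewrite mem_iota.
rewrite !mem_blk.
have -> : ((b, j) \in [seq (bj.1, l + bj.2) | bj <- interleave lam sg]) =
          (l <= j < l + sumn lam).
  apply/mapP/andP => [[[c k]]|[le_lj lt_j]].
    by rewrite IH //= => lt_k [_ ->]; rewrite leq_addr ltn_add2l.
  by exists (b, j - l); rewrite /= ?IH ?ltn_subLR // subnKC.
case: (ltnP j l) => [lt_jl|le_lj]; last by rewrite !andbF.
by rewrite ltn_addr // !andbT; case: b s {mem_blk} => [] [].
Qed.

(** Two entries lie in one half of a block, in different blocks, or in opposite halves of one block;
    [R1], [R2] and [R3] settle these cases. [R] is generalised in the induction because the tail is
    compared through a shift by [l]. *)
Lemma interleave_sorted (lam : seq nat) (sg : seq bool)
    (R : rel (bool * nat)) :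
    size sg = size lam ->
    (forall b j k, j < k < sumn lam -> R (b, j) (b, k)) ->
    (forall b c j k, j < sumn lam -> k < sumn lam ->
       part lam j < part lam k -> R (b, j) (c, k)) ->
    (forall j k, j < sumn lam -> k < sumn lam -> part lam j = part lam k ->
       let s := nth true sg (part lam j) in R (s, j) (~~ s, k)) ->
  pairwise R (interleave lam sg).
Proof.
elim: lam sg R => [|l lam IH] [|s sg] R //= [] sz R1 R2 R3.
have iota_lt k : k \in iota 0 l -> k < l by rewrite mem_iota.
have ltD k : k < l -> k < l + sumn lam by move=> ?; rewrite ltn_addr.
have partS k : (l + k < l) = false by rewrite ltnNge leq_addr.
have Rblk c : pairwise R [seq (c, j) | j <- iota 0 l].
  rewrite pairwise_map.
  have: pairwise ltn (iota 0 l).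
    by rewrite -(sorted_pairwise ltn_trans) iota_ltn_sorted.
  have /allP all_l : {in iota 0 l, forall k, k < l} by [].
  apply: (sub_in_pairwise (P := ltn^~ l)) => // i k _ lt_k lt_ik /=.
  by apply: R1; apply/andP; split; [exact: lt_ik | exact/ltD/lt_k].
rewrite !pairwise_cat !Rblk pairwise_map /=.
have tail c : allrel R [seq (c, j) | j <- iota 0 l]
    [seq (bj.1, l + bj.2) | bj <- interleave lam sg].
  apply/allrelP => u v /mapP[j /iota_lt lt_j ->] /mapP[[b k]].
  rewrite mem_interleave // => lt_k -> /=.
  by apply: R2; rewrite ?(ltD j) ?ltn_add2l // partS lt_j.
rewrite !allrel_catr !tail /= !andbT; apply/andP; split.
  apply/allrelP => _ _ /mapP[j /iota_lt lt_j ->] /mapP[k /iota_lt lt_k ->].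
  have := R3 j k (ltD _ lt_j) (ltD _ lt_k); rewrite lt_j lt_k; exact.
apply: IH => // [b j k /andP[lt_j lt_k]|b c j k lt_j lt_k lt_jk|j k lt_j lt_k e] /=.
- by apply: R1; rewrite !ltn_add2l lt_j.
- by apply: R2; rewrite ?ltn_add2l // !partS !addKn.
have := R3 (l + j) (l + k); rewrite !ltn_add2l !partS !addKn /= e.
exact.
Qed.

(** * The lexicographic order of the keys *)

(* Vertices are ordered by the lexicographic order of their keys. Subtracting
   from n P reverses the order in the blocks that read B^k A^k. *)
Fixpoint key (r : nat) (n x : (2 * r).-tuple letter -> nat)
    (Ps : seq (seq nat * (2 * r).-tuple letter)) (j : nat) : seqlexi nat :=
  if Ps is (lam, P) :: Ps' then
    [:: part lam j,
        (if nth true (signs lam P) (part lam j) then x P else n P - x P)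
      & key r n x Ps' j]
  else [:: j].

Lemma ltxi_lehead_cons (a b : nat) (s t : seqlexi nat) :
    a <= b -> (a = b -> (s < t)%O) ->
  ((a :: s : seqlexi nat) < (b :: t : seqlexi nat))%O.
Proof.
move=> le_ab h; rewrite ltxi_cons !leEnat le_ab /=; apply/implyP => le_ba.
by apply: h; apply/eqP; rewrite eqn_leq le_ab.
Qed.

Section Keys.
Context {r : nat}.
Implicit Types (n x y : (2 * r).-tuple letter -> nat)
  (Ps : seq (seq nat * (2 * r).-tuple letter)).

Lemma key_ltn n x Ps j k : j < k -> (key r n x Ps j < key r n x Ps k)%O.
Proof.
move=> lt_jk; elim: Ps => [|[lam P] Ps IH] /=.
  by apply: ltxi_lehead_cons => [|e]; [exact: ltnW | move: lt_jk; rewrite e ltnn].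
apply: ltxi_lehead_cons => [|<-]; first exact/part_le/ltnW.
by rewrite eqhead_ltxiE.
Qed.

(** The hypothesis on [lam] forces [j < k], so an earlier partition that separates [j] from [k] does
    so in the same direction. If it does not separate them, the coordinate entry that follows is the
    same in both keys. *)
Lemma key_lt_part n x y Ps1 Ps2 lam P j k :
    all (fun u => x u.2 == y u.2) Ps1 ->
    part lam j < part lam k ->
  (key r n x (Ps1 ++ (lam, P) :: Ps2) j <
   key r n y (Ps1 ++ (lam, P) :: Ps2) k)%O.
Proof.
move=> + lt_part; elim: Ps1 => [|[mu Q] Ps1 IH] /=.
  move=> _; apply: ltxi_lehead_cons => [|e]; first exact: ltnW.
  by move: lt_part; rewrite e ltnn.
case/andP => /eqP e /IH{}IH; apply: ltxi_lehead_cons => [|<-].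
  apply/part_le/ltnW; rewrite ltnNge; apply/negP => /(part_le lam).
  by rewrite leqNgt lt_part.
by rewrite e eqhead_ltxiE.
Qed.

(** Positions in one part of [lam] share a part of every coarser partition, so the keys coincide up
    to the entry of [P], which decides. *)
Lemma key_lt_sign n x y Ps1 Ps2 lam P j k :
    all (fun u => refines r u.1 lam) Ps1 ->
    all (fun u => x u.2 == y u.2) Ps1 ->
    j < r -> k < r -> part lam j = part lam k -> x P < n P ->
    (if nth true (signs lam P) (part lam j) then x P < y P else y P < x P) ->
  (key r n x (Ps1 ++ (lam, P) :: Ps2) j <
   key r n y (Ps1 ++ (lam, P) :: Ps2) k)%O.
Proof.
move=> + + lt_j lt_k e_part lt_x; elim: Ps1 => [|[mu Q] Ps1 IH] /=.
  move=> _ _ lt_xy; rewrite e_part eqhead_ltxiE -e_part.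
  apply: ltxi_lehead_cons; move: lt_xy; case: ifP => _ lt_xy.
  - exact: ltnW.
  - by apply: leq_sub2l; exact: ltnW.
  - by move=> e; move: lt_xy; rewrite e ltnn.
  (* Truncated subtraction from [n P] is strict here since [y P < x P < n P]. *)
  by move=> e; have := ltn_sub2l (ltn_trans lt_xy lt_x) lt_xy; rewrite e ltnn.
case/andP => /refinesP/(_ j k lt_j lt_k e_part) e1 /IH{}IH /andP[/eqP e /IH{}IH] h.
by rewrite e1 e !eqhead_ltxiE IH.
Qed.

End Keys.

(** * The matching built from a list of patterns *)

(** Carries the order of the keys, which live in an infinite type, over to a finite ordered vertex
    type: [v] goes to the number of elements below it. *)
Lemma rank_exists (d : Order.disp_t) (L : orderType d) (V : finType)
    (f : V -> L) : injective f ->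
  exists g : V -> 'I_#|V|,
    bijective g /\ forall u v, (f u < f v)%O -> (g u < g v)%O.
Proof.
move=> f_inj; pose below v := [set u | (f u < f v)%O].
have lt_below v : #|below v| < #|V|.
  rewrite -cardsT; apply: proper_card; rewrite properT.
  by apply/negP => /eqP/setP/(_ v); rewrite !inE ltxx.
pose g v := Ordinal (lt_below v).
have g_lt u v : (f u < f v)%O -> (g u < g v)%O.
  move=> lt_uv; rewrite ltEord; apply: proper_card; apply/properP; split.
    by apply/subsetP => w; rewrite !inE => /lt_trans; apply.
  by exists u; rewrite inE ?ltxx.
exists g; split=> //; apply: inj_card_bij; last by rewrite card_ord.
move=> u v e; apply: f_inj; apply/eqP.
by case: ltgtP => // /g_lt; rewrite e ltxx.
Qed.

(** The sorted enumeration of the union is unique, and its first vertex makes [e] the edge written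
    A, whichever argument comes first. *)
Lemma formed_pattern_sorted (d : Order.disp_t) (T : finOrderType d)
    (e f : {set T}) (s : seq T) (w := [seq if v \in e then A else B | v <- s]) :
    [disjoint e & f] -> sorted <%O s -> s =i e :|: f -> ohead w = Some A ->
  formed_pattern e f = w /\ formed_pattern f e = w.
Proof.
move=> dis s_sorted s_mem head_w.
have sortE (E : {set T}) : s =i E -> sort <=%O (enum E) = s.
  move=> mem; apply: lt_sorted_eq => //; first by rewrite sort_lt_sorted enum_uniq.
  by move=> v; rewrite mem_sort mem_enum mem.
rewrite /formed_pattern (setUC f) (sortE _ s_mem) {sortE s_mem s_sorted}.
rewrite {}/w in head_w *; case: s head_w => //= v s; case: ifP => // v_e _.
by rewrite (disjointFr dis v_e) v_e.
Qed.

Lemma first_difference (I : Type) (J : eqType) (p : I -> J) (s : seq I)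
    (x y : J -> nat) : has (fun u => x (p u) != y (p u)) s ->
  exists s1 u s2, [/\ s = s1 ++ u :: s2, x (p u) != y (p u)
    & all (fun v => x (p v) == y (p v)) s1].
Proof.
move=> h; case: (split_find h) => u s1 s2 ne_u no_s1.
exists s1, u, s2; split; rewrite ?cat_rcons //.
by move: no_s1; rewrite -all_predC; apply: sub_all => v /=; rewrite negbK.
Qed.

(** Equal part indices give equal signs, and subtraction from [n P] is injective on values below
    [n P]. *)
Lemma key_inj (r : nat) (n x y : (2 * r).-tuple letter -> nat)
    (Ps : seq (seq nat * (2 * r).-tuple letter)) (j k : nat) :
    (forall P, x P < n P) -> (forall P, y P < n P) ->
    key r n x Ps j = key r n y Ps k ->
  j = k /\ ~~ has (fun u => x u.2 != y u.2) Ps.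
Proof.
move=> lt_x lt_y; elim: Ps => [|[lam P] Ps IH] /=; first by case.
case=> e_part; rewrite e_part => e_xy /IH[-> /negbTE->]; split=> //.
rewrite orbF negbK; apply/eqP; move: e_xy; case: ifP => _ // e.
by rewrite -(subKn (ltnW (lt_x P))) e subKn // ltnW.
Qed.

(** Edges have a coordinate for every pattern, which gives the full product. Coordinates outside
    [Ps] take at most one value, so distinct edges differ at a listed pattern. Edges are nonempty as
    [r > 0], hence distinct for distinct vectors. *)
Lemma blowup (r : nat) (r_gt0 : 0 < r) (n : (2 * r).-tuple letter -> nat)
    (Ps : seq (seq nat * (2 * r).-tuple letter)) :
    pairwise (fun u v => refines r u.1 v.1) Ps ->
    all (fun u => (sumn u.1 == r) && (u.2 \in patterns_of r u.1)) Ps ->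
    (forall P, P \notin [seq u.2 | u <- Ps] -> n P <= 1) ->
  exists (d : Order.disp_t) (T : finOrderType d) (H : {set {set T}}),
    [/\ ordered_matching r H,
        forall (P : (2 * r).-tuple letter) (K : {set {set T}}),
          K \subset H -> is_clique P K -> #|K| <= n P
      & #|H| = \prod_P n P].
Proof.
move=> Ps_ref Ps_pat n_le1.
pose X := {dffun forall P : (2 * r).-tuple letter, 'I_(n P)}.
pose crd (x : X) P : nat := x P.
have crd_lt x P : crd x P < n P by apply: ltn_ord.
pose kf (v : X * 'I_r) := key r n (crd v.1) Ps v.2.
have diff (x y : X) : x != y -> has (fun u => crd x u.2 != crd y u.2) Ps.
  apply: contraR; rewrite -all_predC => /allP same.
  apply/eqP/ffunP => P; apply/val_inj => /=.
  have [/mapP[u u_Ps ->]|/n_le1 le1] := boolP (P \in [seq u.2 | u <- Ps]).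
    by have /= := same _ u_Ps; rewrite negbK => /eqP.
  have eq0 (z : X) : z P = 0 :> nat.
    by apply/eqP; rewrite -leqn0 -ltnS (leq_trans (ltn_ord _)).
  by rewrite !eq0.
have kf_inj : injective kf.
  case=> [x j] [y k] /key_inj[] // /= e_jk; rewrite (val_inj e_jk).
  by have [->//|/diff->] := eqVneq x y.
have [g [g_bij g_lt]] := rank_exists _ _ _ _ kf_inj.
have g_inj := bij_inj g_bij.
pose edge x : {set 'I_#|{: X * 'I_r}|} := [set g (x, j) | j : 'I_r].
have mem_edge x y j : (g (y, j) \in edge x) = (y == x).
  apply/imsetP/eqP => [[k _ /g_inj[]]//|->]; by exists j.
have edge_dis x y : x != y -> [disjoint edge x & edge y].
  move=> ne; apply/pred0P => v /=; apply/negP => /andP[/imsetP[j _ ->]].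
  by rewrite mem_edge (negbTE ne).
have edge_inj : injective edge.
  move=> x y e; apply/eqP; rewrite -(mem_edge y x (Ordinal r_gt0)) -e.
  by rewrite mem_edge.
have edge_pat x y : x != y -> exists2 P, crd x P != crd y P &
    formed_pattern (edge x) (edge y) = P.
  move=> ne_xy; have ne_yx : y != x by rewrite eq_sym.
  have [Ps1 [[lam P] [Ps2 [e_Ps /= neP same]]]] :=
    first_difference _ _ _ _ _ _ (diff x y ne_xy).
  exists P => //.
  have same' : all (fun u => crd y u.2 == crd x u.2) Ps1.
    by move: same; apply: sub_all => u; rewrite eq_sym.
  have ref : all (fun u => refines r u.1 lam) Ps1.
    move: Ps_ref; rewrite e_Ps pairwise_cat allrel_consr.
    by case/andP => /andP[].
  have [/eqP sum_lam patP] : sumn lam == r /\ P \in patterns_of r lam.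
    by apply/andP; move: Ps_pat; rewrite e_Ps all_cat /= => /andP[_ /andP[]].
  move: patP; rewrite inE => /andP[/andP[/eqP headP _] blkP].
  have sz_sg : size (signs lam P) = size lam.
    by rewrite !size_map size_reshape size_map.
  (* By symmetry [a] has the smaller coordinate and is the edge written A. Agreement on [Ps1] is
     kept in both directions, because vertices of [b] precede those of [a] in the blocks of negative
     sign. *)
  suff main (a b : X) : a != b -> crd a P < crd b P ->
      all (fun u => crd a u.2 == crd b u.2) Ps1 ->
      all (fun u => crd b u.2 == crd a u.2) Ps1 ->
      formed_pattern (edge a) (edge b) = P /\
      formed_pattern (edge b) (edge a) = P.
    by case: (ltngtP (crd x P) (crd y P)) neP => // lt _; case: (main _ _ _ lt).
  move=> {x y ne_xy ne_yx neP same same'} ne lt_ab same same'.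
  (* Interleaved positions are below [sumn lam = r], so [insubd] returns them unchanged. *)
  pose vert (bj : bool * nat) :=
    g (if bj.1 then a else b, insubd (Ordinal r_gt0) bj.2).
  have letters : [seq if v \in edge a then A else B |
      v <- [seq vert bj | bj <- interleave lam (signs lam P)]] = P.
    rewrite -map_comp -[RHS](letters_interleave _ _ blkP); apply: eq_map => -[c j].
    rewrite /= mem_edge /letter_of; case: c; rewrite ?eqxx //.
    by rewrite eq_sym (negbTE ne).
  rewrite -letters; apply: formed_pattern_sorted; last by rewrite letters.
  - exact: edge_dis.
  - rewrite lt_sorted_pairwise pairwise_map.
    have val_ins j : j < sumn lam -> insubd (Ordinal r_gt0) j = j :> nat.
      by rewrite sum_lam => lt_j; rewrite val_insubd lt_j.
    apply: interleave_sorted => // [c j k /andP[lt_jk lt_k]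
      |c c' j k lt_j lt_k lt_part|j k lt_j lt_k e_part] /=;
      apply: g_lt; rewrite /kf /= !val_ins ?(ltn_trans lt_jk) //.
    + exact: key_ltn.
    + rewrite e_Ps; apply: key_lt_part lt_part.
      by case: c c' => [] [] //; apply/allP.
    rewrite sum_lam in lt_j lt_k; rewrite e_Ps.
    case e_s : (nth _ _ _) => /=; apply: key_lt_sign => //; by rewrite e_s.
  move=> v; rewrite in_setU; apply/mapP/orP.
    by case=> -[[] j] _ ->; [left | right]; rewrite mem_edge.
  by case=> /imsetP[j _ ->]; [exists (true, val j) | exists (false, val j)];
    rewrite ?mem_interleave ?sum_lam //= /vert /= valKd.
exists _, 'I_#|{: X * 'I_r}|, [set edge x | x : X]; split.
- apply/and3P; split.
  + apply/eqP/setP => v; rewrite inE; have [g' _ gK] := g_bij.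
    rewrite -(gK v); case: (g' v) => x j; apply/bigcupP.
    by exists (edge x); rewrite ?mem_edge // imset_f.
  + apply/trivIsetP => _ _ /imsetP[x _ ->] /imsetP[y _ ->] ne.
    by apply: edge_dis; apply: contraNneq ne => ->.
  apply/forall_inP => _ /imsetP[x _ ->]; rewrite card_imset ?card_ord //.
  by move=> j k /g_inj[].
- move=> P K /subsetP K_H /forall_inP clique.
  have K_edge e : e \in K -> exists x, e = edge x.
    by move/K_H/imsetP => [x _ ->]; exists x.
  pose L := [set x | edge x \in K].
  have -> : K = edge @: L.
    apply/setP => e; apply/idP/imsetP => [e_K|[x + ->]]; last by rewrite inE.
    by have [x e_x] := K_edge _ e_K; exists x; rewrite ?inE -?e_x.
  rewrite card_imset // -[n P]card_ord -(card_in_imset (f := fun x : X => x P)).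
    exact: max_card.
  move=> x y; rewrite !inE => x_K y_K e; apply/eqP; apply: contraTT isT => ne.
  have [Q neQ patQ] := edge_pat _ _ ne.
  have := forall_inP (clique _ x_K) _ y_K; rewrite patQ (inj_eq edge_inj) ne /=.
  by move/eqP/val_inj => eQ; move: neQ; rewrite eQ /crd e eqxx.
rewrite card_imset // card_dep_ffun foldrE big_map big_enum /=.
by apply: eq_bigr => P _; rewrite card_ord.
Qed.

(** * The patterns along a maximising chain *)

Definition leveled_patterns (r : nat) (c : seq (seq nat)) :
    seq (seq nat * (2 * r).-tuple letter) :=
  [seq (lam, P) | lam <- c, P <- enum (patterns_of r lam)].

Lemma mem_leveled_patterns (r : nat) (c : seq (seq nat))
    (u : seq nat * (2 * r).-tuple letter) :
  (u \in leveled_patterns r c) = (u.1 \in c) && (u.2 \in patterns_of r u.1).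
Proof.
apply/allpairsPdep/andP => [[lam [P [lam_c + ->]]]|[lam_c P_lam]] /=.
  by rewrite mem_enum.
by exists u.1, u.2; rewrite mem_enum -surjective_pairing.
Qed.

(** Coarser levels are listed first; within a level any order will do, by reflexivity. *)
Lemma leveled_patterns_refines (r : nat) (c : seq (seq nat)) :
    pairwise (refines r) c ->
  pairwise (fun u v => refines r u.1 v.1) (leveled_patterns r c).
Proof.
elim: c => //= lam c IH /andP[/allP lam_c /IH{}IH].
rewrite pairwise_cat {}IH andbT; apply/andP; split.
  apply/allrelP => u v /mapP[P _ ->]; rewrite mem_leveled_patterns.
  by case/andP => /lam_c.
rewrite pairwise_map; elim: (enum _) => //= P s ->.
by rewrite andbT; apply/allP => Q _; exact: refines_refl.
Qed.

Theorem theorem1p3 (r : nat) (r_gt0 : 0 < r)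
    (m : (2 * r).-tuple letter -> nat)
    (m_gt0 : forall P : (2 * r).-tuple letter, collectable P -> 0 < m P) :
  exists (d : Order.disp_t) (T : finOrderType d) (H : {set {set T}}),
    [/\ ordered_matching r H,
        forall P : (2 * r).-tuple letter, collectable P ->
          forall K : {set {set T}}, K \subset H -> is_clique P K -> #|K| <= m P
      & #|H| = \max_(c : r.-tuple (small_seq r) | is_chain c)
                 \prod_(P in \bigcup_(i < r) patterns_of r (parts (tnth c i)))
                   m P].
Proof.
(* If there were no chain, the maximum would be 0 and the empty matching would attain it; this
   spares constructing a chain. *)
case: (posnP #|[pred c : r.-tuple (small_seq r) | is_chain c]|) => [no_chain|].
  exists _, 'I_0, set0; split.
  - rewrite /ordered_matching; apply/and3P; split.
    + by apply/eqP/setP => -[].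
    + by apply/trivIsetP => e f; rewrite inE.
    + by apply/forall_inP => e; rewrite inE.
  - by move=> P _ K; rewrite subset0 => /eqP->; rewrite cards0.
  by rewrite cards0 big_pred0 // => c; exact: (card0_eq no_chain c).
case/(eq_bigmax_cond (fun c : r.-tuple (small_seq r) =>
  \prod_(P in \bigcup_(i < r) patterns_of r (parts (tnth c i))) m P)) => c.
rewrite inE => chain_c ->.
set S := \bigcup_(i < r) _.
pose cs := [seq parts lam | lam <- c].
(* The value 1 outside [S] leaves the product unchanged, and as a clique bound it is at most [m P]
   for collectable [P]. *)
pose n P := if P \in S then m P else 1.
have mem_S P : (P \in S) = (P \in [seq u.2 | u <- leveled_patterns r cs]).
  apply/bigcupP/mapP => [[i _ P_i]|[u]].
    exists (parts (tnth c i), P) => //.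
    by rewrite mem_leveled_patterns /= P_i map_f // mem_tnth.
  rewrite mem_leveled_patterns => /andP[/mapP[lam /tnthP[i ->] e] u_P] ->.
  by exists i => //; rewrite -e.
have /and3P[/allP part_c _ split_c] := chain_c.
have ref_cs : pairwise (refines r) cs.
  rewrite -(sorted_pairwise (@refines_trans r)) sorted_map.
  by apply: sub_sorted split_c => lam mu; exact: splits_refines.
have pat_cs : all (fun u => (sumn u.1 == r) && (u.2 \in patterns_of r u.1))
    (leveled_patterns r cs).
  apply/allP => u; rewrite mem_leveled_patterns => /andP[/mapP[lam lam_c e] ->].
  by rewrite andbT e; case/andP: (part_c _ lam_c).
have n_le1 P : P \notin [seq u.2 | u <- leveled_patterns r cs] -> n P <= 1.
  by rewrite -mem_S /n => /negbTE->.
have [d [T [H [match_H clique_H card_H]]]] :=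
  blowup _ r_gt0 n _ (leveled_patterns_refines _ _ ref_cs) pat_cs n_le1.
exists d, T, H; split=> //; last by rewrite card_H [RHS]big_mkcond.
move=> P coll_P K K_H /(clique_H _ _ K_H)/leq_trans; apply.
by rewrite /n; case: ifP => // _; exact: m_gt0.
Qed.
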